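(* Let $\Gamma$ be the group given by the presentation $$\Gamma = \bigl\langle\, a, b \;\bigm|\; a b a^2 b^{-1} a^2 b^{-2},\;\; a b^3 a b^4 a^{-1} b \,\bigr\rangle .$$ Then $\Gamma$ does not have the unique-product property (in Lean/Mathlib terms, with $\Gamma$ constructed as a `PresentedGroup` on these two relators, `¬ UniqueProds Gamma`).
   Context: A group $G$ has the unique-product property (has unique products) if for all finite nonempty subsets $A, B \subseteq G$ there exists $x \in AB$ that has exactly one representation $x = \alpha\beta$ with $\alpha \in A$, $\beta \in B$. This is the property expressed by Mathlib's class `UniqueProds`. *)

(* Defs.v *)
From HB Require Import structures.
From mathcomp Require Import all_boot finmap.
From mathcomp Require Import boolp classical_sets.

Set Implicit Arguments.
Unset Strict Implicit.
Unset Printing Implicit Defensive.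

Local Open Scope classical_set_scope.
Local Open Scope group_scope.
Local Open Scope quotient_scope.

(* The letter (x, false) stands for x and (x, true) for its formal inverse. *)
Inductive free_eq (X : Type) : seq (X * bool) -> seq (X * bool) -> Prop :=
| free_eq_refl u : free_eq u u
| free_eq_sym u v : free_eq u v -> free_eq v u
| free_eq_trans v u w : free_eq u v -> free_eq v w -> free_eq u w
| free_eq_cancel u v x e : free_eq (u ++ (x, e) :: (x, ~~ e) :: v) (u ++ v).

Section FreeGroup.
Variables (X : choiceType).
Implicit Types (u v w : seq (X * bool)) (e : bool).

Definition free_rel : rel (seq (X * bool)) := fun u v => `[< free_eq u v >].

Lemma free_rel_refl : reflexive free_rel.
Proof. by move=> u; apply/asboolP/free_eq_refl. Qed.

Lemma free_rel_sym : symmetric free_rel.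
Proof. by move=> u v; apply/asboolP/asboolP => /free_eq_sym. Qed.

Lemma free_rel_trans : transitive free_rel.
Proof.
by move=> v u w /asboolP uv /asboolP vw; apply/asboolP/(free_eq_trans uv).
Qed.

Canonical free_equiv_rel := EquivRel free_rel free_rel_refl free_rel_sym
  free_rel_trans.

Definition free_group : Type := {eq_quot free_rel}.
HB.instance Definition _ := Choice.on free_group.
HB.instance Definition _ := EqQuotient.on free_group.

Lemma free_eq_cat u u' v v' :
  free_eq u u' -> free_eq v v' -> free_eq (u ++ v) (u' ++ v').
Proof.
move=> uu' vv'; apply: (@free_eq_trans _ (u' ++ v)).
  elim: uu' => {u u'} [u|u w _|w u z _ + _|u w x e].
  - exact: free_eq_refl.
  - exact: free_eq_sym.
  - exact: free_eq_trans.
  - by rewrite -!catA; apply: free_eq_cancel.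
elim: vv' => {v v'} [v|v w _|w v z _ + _|v w x e].
- exact: free_eq_refl.
- exact: free_eq_sym.
- exact: free_eq_trans.
- by rewrite !catA; apply: free_eq_cancel.
Qed.

Definition word_inv u := rev [seq (l.1, ~~ l.2) | l <- u].

Lemma word_invK : involutive word_inv.
Proof.
move=> u; rewrite /word_inv map_rev revK -map_comp map_id_in // => -[x e] _ /=.
by rewrite negbK.
Qed.

Lemma free_eq_inv u v : free_eq u v -> free_eq (word_inv u) (word_inv v).
Proof.
elim=> {u v} [u|u v _|v u w _ + _|u v x e].
- exact: free_eq_refl.
- exact: free_eq_sym.
- exact: free_eq_trans.
rewrite /word_inv !map_cat !rev_cat /= !rev_cons -!cats1 -!catA /= negbK.
exact: free_eq_cancel.
Qed.

Lemma free_eq_mulVw u : free_eq (word_inv u ++ u) [::].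
Proof.
elim: u => [|[x e] u IHu]; first exact: free_eq_refl.
apply: free_eq_trans IHu.
rewrite /word_inv /= rev_cons -cats1 -catA /= -[e in (x, e) :: u]negbK.
exact: free_eq_cancel.
Qed.

Definition free_one : free_group := \pi_free_group [::].
Definition free_mul := lift_op2 free_group cat.
Definition free_inv := lift_op1 free_group word_inv.

Lemma free_piP u v : reflect (\pi_free_group u = \pi_free_group v) (free_rel u v).
Proof. exact: eqmodP. Qed.

Lemma pi_free_mul : {morph \pi_free_group : u v / u ++ v >-> free_mul u v}.
Proof.
move=> u v; unlock free_mul; apply/free_piP/asboolP/free_eq_cat;
  by apply/asboolP/free_piP; rewrite reprK.
Qed.

Lemma pi_free_inv : {morph \pi_free_group : u / word_inv u >-> free_inv u}.
Proof.
move=> u; unlock free_inv; apply/free_piP/asboolP/free_eq_inv.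
by apply/asboolP/free_piP; rewrite reprK.
Qed.

Fact free_mulA : associative free_mul.
Proof.
move=> x y z; rewrite -[x]reprK -[y]reprK -[z]reprK.
by rewrite -!pi_free_mul catA.
Qed.

Fact free_mul1 : left_id free_one free_mul.
Proof. by move=> x; rewrite -[x]reprK -pi_free_mul. Qed.

Fact free_mulr1 : right_id free_one free_mul.
Proof. by move=> x; rewrite -[x]reprK -pi_free_mul cats0. Qed.

Fact free_mulV : left_inverse free_one free_inv free_mul.
Proof.
move=> x; rewrite -[x]reprK -pi_free_inv -pi_free_mul.
exact/free_piP/asboolP/free_eq_mulVw.
Qed.

Fact free_mulrV : right_inverse free_one free_inv free_mul.
Proof.
move=> x; rewrite -[x]reprK -pi_free_inv -pi_free_mul.
apply/free_piP/asboolP; rewrite -[u in u ++ _]word_invK; exact: free_eq_mulVw.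
Qed.

HB.instance Definition _ := isGroup.Build free_group
  free_mulA free_mul1 free_mulr1 free_mulV free_mulrV.

Definition free_gen (x : X) : free_group := \pi_free_group [:: (x, false)].

End FreeGroup.

Definition normal_subgroup (G : groupType) (N : set G) : Prop :=
  [/\ N 1, forall x y, N x -> N y -> N (x * y), forall x, N x -> N x^-1
    & forall x y, N x -> N (x ^ y)].

Definition normal_closure (G : groupType) (R : set G) : set G :=
  smallest (@normal_subgroup G) R.

Section PresentedGroup.
Variables (X : choiceType) (R : set (free_group X)).
Implicit Types x y z : free_group X.

Definition presented_rel : rel (free_group X) :=
  fun x y => `[< normal_closure R (x^-1 * y) >].

Lemma normal_closureP : normal_subgroup (normal_closure R).
Proof.
split.
- by move=> N [[]].
- by move=> x y Nx Ny N NR; have [[_ + _ _] _] := NR; apply; [exact: Nx|exact: Ny].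
- by move=> x Nx N NR; have [[_ _ + _] _] := NR; apply; exact: Nx.
- by move=> x y Nx N NR; have [[_ _ _ +] _] := NR; apply; exact: Nx.
Qed.

Lemma presented_rel_refl : reflexive presented_rel.
Proof.
by move=> x; apply/asboolP; rewrite mulVg; case: normal_closureP.
Qed.

Lemma presented_rel_sym : symmetric presented_rel.
Proof.
have [_ _ NV _] := normal_closureP.
by move=> x y; apply/asboolP/asboolP => /NV; rewrite invgM invgK.
Qed.

Lemma presented_rel_trans : transitive presented_rel.
Proof.
have [_ NM _ _] := normal_closureP.
move=> y x z /asboolP Nxy /asboolP Nyz; apply/asboolP.
by have := NM _ _ Nxy Nyz; rewrite mulgA mulgK.
Qed.

Canonical presented_equiv_rel := EquivRel presented_rel presented_rel_refl
  presented_rel_sym presented_rel_trans.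

Definition presented_group : Type := {eq_quot presented_rel}.
HB.instance Definition _ := Choice.on presented_group.
HB.instance Definition _ := EqQuotient.on presented_group.

Definition presented_one : presented_group := \pi_presented_group 1.
Definition presented_mul := lift_op2 presented_group *%g.
Definition presented_inv := lift_op1 presented_group (fun x => x^-1).

Lemma presented_piP x y : reflect
  (\pi_presented_group x = \pi_presented_group y) (presented_rel x y).
Proof. exact: eqmodP. Qed.

Lemma pi_presented_mul :
  {morph \pi_presented_group : x y / x * y >-> presented_mul x y}.
Proof.
have [_ NM _ NJ] := normal_closureP.
move=> x y; unlock presented_mul.
set x' := repr _; set y' := repr _.
have /asboolP Nx : presented_rel x x' by apply/presented_piP; rewrite reprK.
have /asboolP Ny : presented_rel y y' by apply/presented_piP; rewrite reprK.
apply/presented_piP/asboolP.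
have := NM _ _ (NJ _ y Nx) Ny.
by rewrite /conjg invgM !mulgA mulgK.
Qed.

Lemma pi_presented_inv :
  {morph \pi_presented_group : x / x^-1 >-> presented_inv x}.
Proof.
have [_ _ NV NJ] := normal_closureP.
move=> x; unlock presented_inv; set x' := repr _.
have /asboolP Nx : presented_rel x x' by apply/presented_piP; rewrite reprK.
apply/presented_piP/asboolP.
have := NJ _ x'^-1 (NV _ Nx).
by rewrite /conjg invgM !invgK !mulgA mulgV mul1g.
Qed.

Fact presented_mulA : associative presented_mul.
Proof.
move=> x y z; rewrite -[x]reprK -[y]reprK -[z]reprK.
by rewrite -!pi_presented_mul mulgA.
Qed.

Fact presented_mul1 : left_id presented_one presented_mul.
Proof. by move=> x; rewrite -[x]reprK -pi_presented_mul mul1g. Qed.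

Fact presented_mulr1 : right_id presented_one presented_mul.
Proof. by move=> x; rewrite -[x]reprK -pi_presented_mul mulg1. Qed.

Fact presented_mulV : left_inverse presented_one presented_inv presented_mul.
Proof.
by move=> x; rewrite -[x]reprK -pi_presented_inv -pi_presented_mul mulVg.
Qed.

Fact presented_mulrV : right_inverse presented_one presented_inv presented_mul.
Proof.
by move=> x; rewrite -[x]reprK -pi_presented_inv -pi_presented_mul mulgV.
Qed.

HB.instance Definition _ := isGroup.Build presented_group
  presented_mulA presented_mul1 presented_mulr1 presented_mulV presented_mulrV.

End PresentedGroup.

Definition unique_products (G : groupType) : Prop :=
  forall A B : {fset G}, A != fset0 -> B != fset0 ->
  exists x : G, exists! p : G * G, [/\ p.1 \in A, p.2 \in B & x = p.1 * p.2].

Definition Gamma_relators : set (free_group bool) :=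
  let a := free_gen false in
  let b := free_gen true in
  [set a * b * a ^+ 2 * b^-1 * a ^+ 2 * b ^- 2;
       a * b ^+ 3 * a * b ^+ 4 * a^-1 * b].

Definition Gamma : groupType := presented_group Gamma_relators.

(* Main.v *)
(* The seven elements a, b, c = b a^2 b^-2, f = b a b^2, x = b^2 a^-1,
   y = (b a)^-1, z = b^-2 satisfy the seven triangle relations
     cca = cxy = bbz = bay = ffx = fzy = azx = 1:
   the first is a conjugate of the first relator, the fifth a conjugate of the
   second one, and the others hold in every group. This is a triangle
   presentation over the projective plane of order 2, so Gamma acts simply
   transitively on the vertices of an A2-tilde building, and rules on pairs of
   letters rewrite every word in the seven generators to the form
   (generators)(inverses of generators).

   The sets A = factorsA and B = factorsB were found by computer: starting
   from balls in the building, greedily delete the factors of uniquely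
   represented products. Every product in AB has two representations whose
   factors in A have distinct images in the abelianization Z/42 of Gamma,
   where a goes to 34 and b to 1; hence these representations differ. *)

Require Import Defs.
From Stdlib Require Import Ascii String.
From mathcomp Require Import all_boot zmodp finmap.
From mathcomp Require Import boolp classical_sets.

Set Implicit Arguments.
Unset Strict Implicit.
Unset Printing Implicit Defensive.

Local Open Scope group_scope.
Local Open Scope quotient_scope.

(** * Homomorphisms out of free groups and of presented groups *)

Section WordLift.
Variables (X : Type) (H : groupType) (h : X -> H).

Definition letter_lift (l : X * bool) : H := if l.2 then (h l.1)^-1 else h l.1.

Definition word_lift (w : seq (X * bool)) : H :=
  foldr (fun l g => letter_lift l * g) 1 w.

Lemma word_lift_cat u v : word_lift (u ++ v) = word_lift u * word_lift v.
Proof. by elim: u => [|l u IHu] /=; rewrite ?mul1g // IHu mulgA. Qed.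

Lemma word_lift_free_eq u v : free_eq u v -> word_lift u = word_lift v.
Proof.
elim=> {u v} [//|u v _ ->//|u v w _ -> _ ->//|u v x e].
rewrite !word_lift_cat /=; congr (_ * _).
by case: e; rewrite /letter_lift /= mulgA ?mulVg ?mulgV mul1g.
Qed.

End WordLift.

Section FreeLift.
Variables (X : choiceType) (H : groupType) (h : X -> H).

Definition free_lift (g : free_group X) : H := word_lift h (repr g).

Lemma free_lift_pi u : free_lift (\pi_(free_group X) u) = word_lift h u.
Proof.
apply/word_lift_free_eq/asboolP.
by apply/(@free_piP X); rewrite reprK.
Qed.

Lemma free_liftM : {morph free_lift : u v / u * v}.
Proof.
move=> u v; rewrite -[u]reprK -[v]reprK.
rewrite [_ * _](_ : _ = \pi_(free_group X) (repr u ++ repr v)); last first.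
  by rewrite pi_free_mul.
by rewrite !free_lift_pi word_lift_cat.
Qed.

Lemma free_lift1 : free_lift 1 = 1.
Proof. exact: free_lift_pi. Qed.

Lemma free_liftV : {morph free_lift : u / u^-1}.
Proof.
by move=> u; apply: (mulIg (free_lift u)); rewrite -free_liftM !mulVg free_lift1.
Qed.

Lemma free_liftX n : {morph free_lift : u / u ^+ n}.
Proof.
by move=> u; elim: n => [|n IHn]; rewrite ?free_lift1 // !expgS free_liftM IHn.
Qed.

Lemma free_lift_gen x : free_lift (free_gen x) = h x.
Proof. by rewrite free_lift_pi /= mulg1. Qed.

End FreeLift.

Section PresentedGroupTheory.
Variables (X : choiceType) (R : set (free_group X)).

Definition presented_gen (x : X) : presented_group R :=
  \pi_(presented_group R) (free_gen x).

Lemma presented_piM :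
  {morph (fun u => \pi_(presented_group R) u) : u v / u * v}.
Proof. by move=> u v; rewrite pi_presented_mul. Qed.

Lemma presented_pi1 : \pi_(presented_group R) 1 = 1 :> presented_group R.
Proof. by []. Qed.

Lemma presented_piV : {morph (fun u => \pi_(presented_group R) u) : u / u^-1}.
Proof. by move=> u; rewrite pi_presented_inv. Qed.

Lemma presented_piX n :
  {morph (fun u => \pi_(presented_group R) u) : u / u ^+ n}.
Proof.
move=> u; elim: n => [|n IHn]; first exact: presented_pi1.
by rewrite !expgS presented_piM IHn.
Qed.

Lemma presented_relator r :
  R r -> \pi_(presented_group R) r = 1 :> presented_group R.
Proof.
move=> Rr; rewrite -presented_pi1; apply/esym/presented_piP/asboolP.
by rewrite invg1 mul1g => N [_ sRN]; apply: sRN.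
Qed.

Variables (H : groupType) (h : X -> H).
Hypothesis hR : forall r, R r -> free_lift h r = 1.

(** The kernel of [free_lift h] is a normal subgroup containing [R], and the closure is the smallest
    such subgroup. *)
Lemma free_lift_normal_closure u : normal_closure R u -> free_lift h u = 1.
Proof.
move/(_ [set v | free_lift h v = 1]%classic); apply; split=> //.
split=> [|v w hv hw|v hv|v w hv].
- exact: free_lift1.
- by rewrite /= free_liftM hv hw mulg1.
- by rewrite /= free_liftV hv invg1.
- by rewrite /= /conjg !free_liftM free_liftV hv mul1g mulVg.
Qed.

Definition presented_lift (g : presented_group R) : H := free_lift h (repr g).

Lemma presented_lift_pi u :
  presented_lift (\pi_(presented_group R) u) = free_lift h u.
Proof.
have /asboolP/free_lift_normal_closure :
    presented_rel R (repr (\pi_(presented_group R) u)) u.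
  by apply/(@presented_piP X R); rewrite reprK.
by rewrite free_liftM free_liftV => /mulg1_eq; rewrite invgK.
Qed.

Lemma presented_liftM : {morph presented_lift : u v / u * v}.
Proof.
move=> u v; rewrite -[u]reprK -[v]reprK -presented_piM.
by rewrite !presented_lift_pi free_liftM.
Qed.

Lemma presented_lift1 : presented_lift 1 = 1.
Proof. by rewrite -presented_pi1 presented_lift_pi free_lift1. Qed.

Lemma presented_liftV : {morph presented_lift : u / u^-1}.
Proof.
move=> u; apply: (mulIg (presented_lift u)).
by rewrite -presented_liftM !mulVg presented_lift1.
Qed.

Lemma presented_liftX n : {morph presented_lift : u / u ^+ n}.
Proof.
move=> u; elim: n => [|n IHn]; first exact: presented_lift1.
by rewrite !expgS presented_liftM IHn.
Qed.

Lemma presented_lift_gen x : presented_lift (presented_gen x) = h x.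
Proof. by rewrite presented_lift_pi free_lift_gen. Qed.

End PresentedGroupTheory.

(** Pairs with distinct left factors are distinct, so no product keeps a unique representation.
    Lists make the condition checkable by computation. *)
Lemma not_unique_products (G : groupType) (A B : seq G) :
    A != [::] -> B != [::] ->
    (forall a b, a \in A -> b \in B -> exists a' b',
      [/\ a' \in A, b' \in B, a' != a & a * b = a' * b']) ->
  ~ unique_products G.
Proof.
move=> A0 B0 AB /(_ [fset a in A]%fset [fset b in B]%fset) [||x].
- case: A A0 {AB} => // a A _; apply/fset0Pn; exists a.
  by rewrite in_fset mem_head.
- case: B B0 {AB} => // b B _; apply/fset0Pn; exists b.
  by rewrite in_fset mem_head.
case=> -[a b] /= [[]]; rewrite !in_fset => aA bB -> uniq_ab.
have [a' [b' [a'A b'B /eqP neq_a eq_ab]]] := AB a b aA bB.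
apply: neq_a; suff -> : a = (a', b').1 by [].
by rewrite -(uniq_ab (a', b')) //= !in_fset.
Qed.

(** * Rewriting words with triangle relations *)

Section Rewriting.
(* (i, true) stands for the inverse of the generator number i, and (i, j, k) in
   T for the relation i j k = 1. *)
Definition letter := (nat * bool)%type.
Definition word := seq letter.
Variable T : seq (nat * nat * nat)%type.

(* The last rule is [i^-1 j = k l^-1] if [i k m = j l m = 1]. *)
Definition rewrite_pair (l1 l2 : letter) : option word :=
  let: (i, d) := l1 in let: (j, e) := l2 in
  if (i == j) && (d != e) then Some [::] else
  match d, e with
  | false, false =>
    ohead [seq [:: (t.2, true)] | t <- T & t.1 == (i, j)]
  | true, true =>
    ohead [seq [:: (t.2, false)] | t <- T & t.1 == (j, i)]
  | true, false =>
    ohead (flatten [seq [seq [:: (t.1.2, false); (u.1.2, true)] |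
                         u <- T & (u.1.1 == j) && (u.2 == t.2)] |
                    t <- T & t.1.1 == i])
  | false, true => None
  end.

(** The prefix [u] is stored reversed, its last letter at the head. The result of a rewrite returns
    to [v], to be matched with the letters before it. The fuel [n] bounds the number of steps. *)
Fixpoint normal_form (n : nat) (u v : word) : word :=
  if n is n'.+1 then
    match v with
    | [::] => rev u
    | l :: v' =>
      match u with
      | [::] => normal_form n' [:: l] v'
      | k :: u' => if rewrite_pair k l is Some w then normal_form n' u' (w ++ v')
                   else normal_form n' (l :: u) v'
      end
    end
  else rev u ++ v.

Variables (G : groupType) (g : nat -> G).
Hypothesis gT :
  forall i j k, (i, j, k) \in T -> g i * g j * g k = 1.

Lemma rewrite_pair_sound l1 l2 w :
  rewrite_pair l1 l2 = Some w ->
  word_lift g w = letter_lift g l1 * letter_lift g l2.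
Proof.
have oheadP (S : eqType) (s : seq S) t : ohead s = Some t -> t \in s.
  by case: s => //= t' s [->]; rewrite mem_head.
case: l1 l2 => [i d] [j e]; rewrite /rewrite_pair /letter_lift /=.
case: ifP => [/andP[/eqP-> de] [<-]|_].
  by case: d e de => [] [] //= _; rewrite ?mulVg ?mulgV.
case: d; case: e => //= /oheadP.
- move=> /mapP[[[? ?] k]]; rewrite mem_filter /= => /andP[/eqP[-> ->] /gT jik ->].
  by rewrite /= mulg1 -invgM (mulg1_eq jik).
- move=> /flatten_mapP[[[? k] m]]; rewrite mem_filter => /andP[/eqP/= -> /gT ikm].
  move=> /mapP[[[? l] n]]; rewrite mem_filter /=.
  move=> /andP[/andP[/eqP-> /eqP->] /gT jlm ->]; rewrite /= mulg1.
  apply: (mulgI (g i)); rewrite mulVKg; apply: (mulIg (g l)).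
  rewrite -!mulgA mulVg mulg1; apply: (mulIg (g m)).
  by rewrite ikm jlm.
- move=> /mapP[[[? ?] k]]; rewrite mem_filter /= => /andP[/eqP[-> ->] /gT ijk ->].
  by rewrite /= mulg1 /letter_lift /= -(mulg1_eq ijk) invgK.
Qed.

Lemma normal_form_sound n u v :
  word_lift g (normal_form n u v) = word_lift g (rev u) * word_lift g v.
Proof.
elim: n u v => [|n IHn] u v /=; first by rewrite word_lift_cat.
case: v => [|l v]; first by rewrite mulg1.
case: u => [|k u]; first by rewrite IHn /= mulg1 mul1g.
case def_w: (rewrite_pair k l) => [w|]; rewrite IHn.
  rewrite word_lift_cat (rewrite_pair_sound def_w).
  by rewrite rev_cons -cats1 word_lift_cat /= mulg1 !mulgA.
by rewrite [rev (l :: _)]rev_cons -cats1 word_lift_cat /= mulg1 !mulgA.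
Qed.

(** Equal normal forms certify equal products, and distinct values of the invariant [r] certify
    distinct left factors. *)
Lemma not_unique_products_words (S : eqType) (r : word -> S) (U V : seq word) n :
    U != [::] -> V != [::] ->
    (forall u v, word_lift g u = word_lift g v -> r u = r v) ->
    (let table :=
       [seq (normal_form n [::] (u ++ v), r u) | u <- U, v <- V] in
     all (fun p => has (fun q => (p.1 == q.1) && (p.2 != q.2)) table) table) ->
  ~ unique_products G.
Proof.
move=> U0 V0 r_lift /= /allP tableP.
apply: (@not_unique_products G (map (word_lift g) U) (map (word_lift g) V)).
- by case: (U) U0.
- by case: (V) V0.
move=> _ _ /mapP[u uU ->] /mapP[v vV ->].
have /hasP[_ /allpairsP[[u' v'] [/= u'U v'V ->]] /andP[/eqP eq_nf neq_r]] :=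
  tableP _ (allpairs_f (fun u v => (normal_form n [::] (u ++ v), r u)) uU vV).
exists (word_lift g u'), (word_lift g v'); split; rewrite ?map_f //.
  by apply: contraNneq neq_r => /r_lift ->.
have nfE w : word_lift g w = word_lift g (normal_form n [::] w).
  by rewrite normal_form_sound mul1g.
by rewrite -!word_lift_cat [LHS]nfE [RHS]nfE eq_nf.
Qed.

End Rewriting.

(* The generators a, b, c, f, x, y, z are numbered 0, ..., 6. *)
Definition triangles : seq (nat * nat * nat)%type :=
  flatten [seq (let: (i, j, k) := t in [:: (i, j, k); (j, k, i); (k, i, j)]) |
    t <- [:: (2, 2, 0); (2, 4, 5); (1, 1, 6); (1, 0, 5); (3, 3, 4); (3, 6, 5);
             (0, 6, 4)]]%N.

Definition letter_of_ascii (x : ascii) : letter :=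
  match x with
  | "a" => (0, false) | "A" => (0, true)
  | "b" => (1%N, false) | "B" => (1%N, true)
  | "c" => (2, false) | "C" => (2, true)
  | "f" => (3, false) | "F" => (3, true)
  | "x" => (4, false) | "X" => (4, true)
  | "y" => (5, false) | "Y" => (5, true)
  | "z" => (6, false) | _ => (6, true)
  end%char.

Definition word_of_string (s : string) : word :=
  map letter_of_ascii (list_ascii_of_string s).

Definition factorsA : seq word := map word_of_string
  [:: ""; "B"; "C"; "z"; "CB"; "FB"; "YB"; "YY"; "bX"; "bY"; "cB"; "cX"; "cY";
      "cz"; "xB"; "xY"; "xz"; "bXB"; "bfB"; "bfY"; "cFB"; "cXB"; "cfB"; "cfY";
      "xAY"; "xzB"; "xzz"; "xzFB"]%string.

Definition factorsB : seq word := map word_of_string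
  [:: ""; "B"; "C"; "X"; "b"; "c"; "y"; "z"; "BC"; "ZC"; "ZX"; "bC"; "bX"; "bc";
      "by"; "xB"; "zC"]%string.

(** * The triangle relations in [Gamma] *)

Definition gamma_gen (i : nat) : Gamma :=
  let a := presented_gen Gamma_relators false in
  let b := presented_gen Gamma_relators true in
  nth 1 [:: a; b; b * a ^+ 2 * b ^- 2; b * a * b ^+ 2; b ^+ 2 * a^-1;
            (b * a)^-1; b ^- 2] i.

Lemma gamma_gen_triangle i j k :
  (i, j, k) \in triangles -> gamma_gen i * gamma_gen j * gamma_gen k = 1.
Proof.
pose a := presented_gen Gamma_relators false.
pose b := presented_gen Gamma_relators true.
have rel1 : a * b * a ^+ 2 * b^-1 * a ^+ 2 * b ^- 2 = 1.
  rewrite /a /b /presented_gen -!(presented_piX, presented_piV, presented_piM).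
  by apply: presented_relator; left.
have rel2 : a * b ^+ 3 * a * b ^+ 4 * a^-1 * b = 1.
  rewrite /a /b /presented_gen -!(presented_piX, presented_piV, presented_piM).
  by apply: presented_relator; right.
(* Rotating a relation conjugates it, so one relation out of each triple in [triangles] suffices. *)
have cyc u v w : gamma_gen u * gamma_gen v * gamma_gen w = 1 ->
    forall t, t \in [:: (u, v, w); (v, w, u); (w, u, v)] ->
    gamma_gen t.1.1 * gamma_gen t.1.2 * gamma_gen t.2 = 1.
  move=> uvw t; rewrite !inE => /or3P[] /eqP-> //=.
    by apply: (mulgI (gamma_gen u)); rewrite !mulgA uvw mul1g mulg1.
  by rewrite -mulgA -(mulg1_eq uvw) mulVg.
pose simplg := (invgM, invgK, expgS, expg0, mulg1, mulgA, mulgV, mulVg, mulgK,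
  mulgVK, mul1g).
(* The first relator is [a (cca) a^-1]; likewise the second is [b^-1 (ffx) b]. *)
have rel1' : gamma_gen 2 * gamma_gen 2 * gamma_gen 0 = 1.
  rewrite /gamma_gen /= -/a -/b; apply: (mulgI a); apply: (mulIg a^-1).
  by rewrite mulg1 mulgV -[RHS]rel1 !simplg.
have rel2' : gamma_gen 3 * gamma_gen 3 * gamma_gen 4 = 1.
  rewrite /gamma_gen /= -/a -/b; apply: (mulgI b^-1); apply: (mulIg b).
  by rewrite mulg1 mulVg -[RHS]rel2 !simplg.
move=> /flatten_mapP[[[u v] w] uvw] /(cyc u v w)/=; apply.
move: uvw; rewrite !inE => /or4P[|||/or4P[]] /eqP[-> -> ->] //;
  by rewrite /gamma_gen /= -/a -/b !simplg.
Qed.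

(** * The character of [Gamma] with values in Z/42 *)

Definition residue (w : word) : nat :=
  sumn [seq let k := nth 0 [:: 34; 1; 25; 37; 10; 7; 40]%N l.1 in
            if l.2 then (42 - k)%N else k | l <- w] %% 42.

(** The group law here is addition modulo [p.+1], in multiplicative notation. *)
Lemma inZpM p m n : inZp m * inZp n = inZp (m + n) :> 'I_p.+1.
Proof. by apply: val_inj; rewrite /= modnDm. Qed.

Definition residue_gen (x : bool) : 'Z_42 := inZp (if x then 1%N else 34).

(** The exponent sums of a and b in the relators are (5, -2) and (1, 8), and both 5 * 34 - 2 = 168
    and 34 + 8 = 42 vanish modulo 42. *)
Lemma residue_gen_relator r :
  Gamma_relators r -> free_lift residue_gen r = 1.
Proof.
by case=> ->; rewrite !(free_liftM, free_liftV, free_liftX, free_lift_gen);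
  apply: val_inj; vm_compute.
Qed.

Definition character : Gamma -> 'Z_42 :=
  presented_lift residue_gen (R := Gamma_relators).

Lemma character_word w :
  character (word_lift gamma_gen w) = inZp (residue w).
Proof.
have chM := presented_liftM residue_gen_relator.
have chV := presented_liftV residue_gen_relator.
have chX n := presented_liftX residue_gen_relator n.
have ch1 : character 1 = 1 := presented_lift1 residue_gen_relator.
have chG := presented_lift_gen residue_gen_relator.
have chgen i :
    character (gamma_gen i) = inZp (nth 0 [:: 34; 1; 25; 37; 10; 7; 40]%N i).
  do 7?[case: i => [|i]; first by
    rewrite /character /gamma_gen /= !(chM, chV, chX, chG); apply: val_inj].
  (* Beyond the seven generators the defaults agree: the trivial element has residue 0. *)
  by rewrite /gamma_gen !nth_default //= ch1; apply: val_inj.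
rewrite /residue; set k := fun l : letter => _.
suff -> : character (word_lift gamma_gen w) = inZp (sumn [seq k l | l <- w]).
  by apply: val_inj; rewrite /= modn_mod.
elim: w => [|[i e] w IHw] /=; first by rewrite ch1; apply: val_inj.
rewrite [character _]chM -inZpM; congr (_ * _); last exact: IHw.
rewrite /letter_lift /k; case: e => //=.
rewrite [LHS]chV [presented_lift _ _]chgen; set n := nth 0 _ i.
(* This bound makes the truncated subtraction [42 - n] a true negation modulo 42. *)
have n_le : n <= 42 by rewrite /n; move: (i); do 8?[case=> //].
by apply: (mulIg (inZp n)); rewrite mulVg inZpM subnK //; apply: val_inj.
Qed.

Theorem mainTheorem1 : ~ unique_products Gamma.
Proof.
(* The words to reduce have at most six letters, for which 100 steps are enough. *)
apply: (@not_unique_products_words _ _ _ gamma_gen_triangle _ residue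
  factorsA factorsB 100); [by []|by []| |by vm_compute].
move=> u v /(congr1 character); rewrite !character_word => /(congr1 val).
by rewrite /residue /= !modn_mod.
Qed.
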